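(* Let $\tilde w\in\tilde S_{n,k}$ be a decorated permutation with associated Grassmann interval $[u,v]$ and positroid $\mathcal M$. For every $y\in[u,v]$, the codimension of the tangent space to $\Pi_{[u,v]}\subseteq Gr(k,n)$ at $A_{y[k]}$ is $$\operatorname{rank}(Jac|_{A_{y[k]}})=\#\Big\{I\in\binom{[n]}{k}\setminus\mathcal M : |I\cap y[k]|=k-1\Big\}.$$
   Context: $[n]=\{1,\dots,n\}$; $\binom{[n]}{k}$ is the set of $k$-subsets. For $r\in[n]$ let $<_r$ be the linear order $r<_r r+1<_r\dots<_r n<_r 1<_r\dots<_r r-1$. For $k$-subsets $I=\{i_1<_r\dots<_r i_k\}$, $J=\{j_1<_r\dots<_r j_k\}$ write $I\preceq_r J$ if $i_h\le_r j_h$ for all $h$; $\preceq$ means $\preceq_1$. For $w\in S_n$, $w[i]=\{w(1),\dots,w(i)\}$. Bruhat order: $u\le v$ iff $u[i]\preceq v[i]$ for all $i$; $[u,v]=\{y\in S_n:u\le y\le v\}$. Products of permutations are compositions. A decorated permutation on $[n]$ is a pair $\tilde w=(w,\mathrm{co})$ with $w\in S_n$ and $\mathrm{co}$ a map from the fixed points of $w$ to $\{\text{clockwise},\text{counterclockwise}\}$. Let $I_r(\tilde w)=\{i\in[n]: i<_r w^{-1}(i)\}\cup\{i: w(i)=i,\ \mathrm{co}(i)=\text{clockwise}\}$; all have the same size, and $\tilde S_{n,k}$ is the set of decorated permutations on $[n]$ for which this size is $k$. Associated Grassmann interval: $v$ is the $k$-Grassmannian permutation ($v_1<\dots<v_k$,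 $v_{k+1}<\dots<v_n$) with $v[k]=w^{-1}(I_1(\tilde w))$, and $u=wv$ (then $u\le v$). Associated positroid: $\mathcal M=\{I\in\binom{[n]}{k}: I_r(\tilde w)\preceq_r I\ \forall r\in[n]\}$. $Gr(k,n)$ is the complex Grassmannian; a point is the row span of a full rank $k\times n$ matrix, and $\Delta_I$ is the maximal minor in columns $I$, a polynomial in variables $x_{ij}$, $i\in[k]$, $j\in[n]$. The positroid variety $\Pi_{[u,v]}=\Pi_{\mathcal M}$ is the subvariety of $Gr(k,n)$ defined by $\Delta_I=0$ for $I\in\mathcal Q=\binom{[n]}{k}\setminus\mathcal M$ (it is known that these generate its vanishing ideal). $Jac$ is the matrix with rows indexed by $I\in\mathcal Q$, columns by the $x_{ij}$ and entries $\partial\Delta_I/\partial x_{ij}$; $Jac|_A$ is its evaluation at a matrix $A$ representing a point, and $\operatorname{rank}(Jac|_A)$ is the codimension of the tangent space to $\Pi_{[u,v]}$ at $A$. For $J=\{j_1,\dots,j_k\}$, $A_J$ is the coordinate subspace spanned by $e_j$, $j\in J$, represented by the $k\times n$ matrix with $1$ in the cells $(i,j_i)$ and zeros elsewhere. *)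

(* Defs.v *)
From HB Require Import structures.
From mathcomp Require Import all_boot all_order all_algebra all_fingroup.
From mathcomp Require Import reals.
From mathcomp Require Import complex mpoly.

Set Implicit Arguments.
Unset Strict Implicit.
Unset Printing Implicit Defensive.

Import GRing.Theory Num.Theory.

Local Open Scope ring_scope.

(* [n] is 'I_n, numbered from 0; in particular the order <_1 and the set I_1
   of the usual 1-based convention are those of index r = 0 here. *)

Section Subsets.
Variable n : nat.
Implicit Types (r : nat) (i j : 'I_n) (I J : {set 'I_n}).

(* Rank of i in the cyclic order r < r+1 < ... < n-1 < 0 < ... < r-1. *)
Definition cyc_pos r i : nat := ((i + (n - r)) %% n)%N.
Definition cyc_lt r i j : bool := (cyc_pos r i < cyc_pos r j)%N.
Definition cyc_le r i j : bool := (cyc_pos r i <= cyc_pos r j)%N.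

Definition cyc_sort r I : seq 'I_n := sort (cyc_le r) (enum I).

(* all2 is false on sequences of different sizes: this relation is meant for
   sets of the same cardinality. *)
Definition gale_le r I J : bool :=
  all2 (cyc_le r) (cyc_sort r I) (cyc_sort r J).

Definition perm_initial (w : 'S_n) (m : nat) : {set 'I_n} :=
  [set w j | j : 'I_n & (j < m)%N].

Definition bruhat_le (u v : 'S_n) : bool :=
  [forall i : 'I_n, gale_le 0 (perm_initial u i.+1) (perm_initial v i.+1)].

Definition bruhat_interval (u v : 'S_n) : {set 'S_n} :=
  [set y | bruhat_le u y && bruhat_le y v].

Definition grassmannian (k : nat) (v : 'S_n) : Prop :=
  forall i j, (i < j)%N -> (j < k)%N || (k <= i)%N -> (v i < v j)%N.

End Subsets.

Variant orientation := Clockwise | Counterclockwise.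

Definition is_clockwise (c : orientation) : bool :=
  if c is Clockwise then true else false.

Record decorated_perm (n : nat) := DecoratedPerm {
  dperm : 'S_n;
  dcolor : {i : 'I_n | dperm i == i} -> orientation
}.

Section Decorated.
Variables (n : nat) (wt : decorated_perm n) (k : nat).
Local Notation w := (dperm wt).

Definition grassmann_necklace (r : nat) : {set 'I_n} :=
  [set i | cyc_lt r i ((w^-1)%g i)]
  :|: [set val h | h : {i : 'I_n | w i == i} & is_clockwise (dcolor h)].

(* The cardinality of grassmann_necklace r is the same for all r < n. *)
Definition of_type : Prop := #|grassmann_necklace 0| = k.

(* MathComp composes permutations left to right: (v * w) i = w (v i), which is
   the product written wv when permutations are composed as functions. *)
Definition grassmann_interval (u v : 'S_n) : Prop :=
  [/\ grassmannian k v,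
      perm_initial v k = [set (w^-1)%g i | i in grassmann_necklace 0]
    & u = (v * w)%g].

Definition positroid : {set {set 'I_n}} :=
  [set I : {set 'I_n} | (#|I| == k)
     && [forall r : 'I_n, gale_le r (grassmann_necklace r) I]].

Definition nonbases : {set {set 'I_n}} :=
  [set I : {set 'I_n} | #|I| == k] :\: positroid.

End Decorated.

(* Maximal minor in the columns I, taken in increasing order; meant for
   #|I| = k, in which case the default value 0 of nth is never used. *)
Definition minor (S : comNzRingType) (k n : nat) (I : {set 'I_n})
    (A : 'M[S]_(k, n)) : S :=
  \det (\matrix_(i < k, a < k) nth 0 [seq A i j | j <- enum I] a).

(* The entry in row i is at the i-th smallest element of J. *)
Definition coord_point (S : comNzRingType) (k n : nat) (J : {set 'I_n}) :
    'M[S]_(k, n) :=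
  \matrix_(i, j) ((j \in J) && (index j (enum J) == i))%:R.

Section Variety.
Variables (C : fieldType) (n k : nat).
Implicit Types (A X : 'M[C]_(k, n)) (f : {mpoly C[k * n]}).

(* The variable x_ij is the variable of index mxvec_index i j, and
   polynomials in the x_ij are evaluated at A via the entries of mxvec A. *)
Definition generic_mx : 'M[{mpoly C[k * n]}]_(k, n) :=
  \matrix_(i, j) 'X_(mxvec_index i j).

Definition eval_at A f : C := f.@[fun c => mxvec A 0 c].

Definition Delta (I : {set 'I_n}) : {mpoly C[k * n]} := minor I generic_mx.

Variable wt : decorated_perm n.
Local Notation Q := (nonbases wt k).

Definition Jac : 'M[{mpoly C[k * n]}]_(#|Q|, k * n) :=
  \matrix_(s, c) (Delta (enum_val s))^`M(c).

Definition Jac_at A : 'M[C]_(#|Q|, k * n) := map_mx (eval_at A) Jac.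

(* A represents a point of the positroid variety; points of Gr(k, n) are
   full rank matrices up to left multiplication by GL_k. *)
Definition in_positroid_variety A : Prop :=
  \rank A = k /\ forall I, I \in Q -> eval_at A (Delta I) = 0.

Definition in_vanishing_ideal f : Prop :=
  forall A, in_positroid_variety A -> eval_at A f = 0.

(* X is tangent at A to the set of full rank matrices representing points of
   the positroid variety. *)
Definition lifted_tangent A X : Prop :=
  forall f, in_vanishing_ideal f ->
    \sum_(i < k) \sum_(j < n) eval_at A (f^`M(mxvec_index i j)) * X i j = 0.

Definition gl_directions A : {vspace 'M[C]_(k, n)} :=
  limg (linfun (@mulmxr _ k k n A)).

(* The tangent space of Gr(k, n) at the row span of A is the quotient of the
   space of k x n matrices by gl_directions A, and that of the positroid
   variety is the image in it of the space T of lifted tangent vectors. *)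
Definition tangent_codim A (d : nat) : Prop :=
  exists2 T : {vspace 'M[C]_(k, n)},
    forall X, X \in T <-> lifted_tangent A X &
    let O := gl_directions A in
    d = ((\dim {:'M[C]_(k, n)} - \dim O) - (\dim (T + O)%VS - \dim O))%N.

End Variety.

(* Main.v *)
Require Import Defs.
From HB Require Import structures.
From mathcomp Require Import all_boot all_order all_algebra all_fingroup.
From mathcomp Require Import reals.
From mathcomp Require Import complex mpoly.
From mathcomp Require Import zify.

(** Both halves of the theorem come from looking at the coordinate point [A] of
[J = y[k]] along the lines [A + t E_ij], where [E_ij] is an elementary matrix.
Every maximal minor restricted to such a line is affine in [t]: its value at
[A] is, up to sign, the indicator of [I = J], and its slope is, up to sign, the
indicator of [I = J \ j_i U {j}] ([minor_line], [minor_unit_rows]).  Hence the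
entry of the Jacobian in row [I] and column [x_ij] is nonzero exactly when
[I = J \ j_i U {j}].

Suppose that [J] is a basis of the positroid, so that [I <> J] for each row [I].
Then every row has at most one nonzero entry and so has every column; the rank
is the number of nonzero rows, and the row [I] is nonzero exactly when [I] is
an exchange of one element of [J], that is, when [|I n J| = k - 1]
([rank_sparse_columns], [exchangeP]).

The tangent space is defined by all polynomials that vanish on the variety, and
is the kernel of the Jacobian even without knowing generators of the ideal.
The kernel is spanned by the [E_ij] for which no nonbasis is
[J \ j_i U {j}].  For these, all minors of nonbases vanish identically on
the line [A + t E_ij], which therefore lies in the variety except for the
finitely many [t] where the rank drops; a polynomial that vanishes on the
variety vanishes on the whole line, and so does its derivative along it
([vanishing_mderiv0], [lifted_tangentE]).  The directions of the [GL_k]-orbit lie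
in this kernel, so that passing to the Grassmannian does not change the
codimension.

It remains to see that [J] is a basis ([interval_sub_positroid]).  The Gale
order says that every initial segment of a cyclic order meets the necklace set
at least as often as it meets [J].  The necklace set [I_r] consists of the values
[u p] with [u p <_r v p] or with [u p] a clockwise fixed point.  As [v] is
Grassmannian, each of the conditions [p >= k, v p >= r] and [p < k, v p < r] cuts
out a final or an initial segment of positions, to which the Bruhat inequalities
between [u], [y] and [v] apply; the first one settles the cyclic intervals that
do not wrap around, and the second one, by complementation, those that do. *)

Set Implicit Arguments.
Unset Strict Implicit.
Unset Printing Implicit Defensive.

Import GRing.Theory Num.Theory.

Local Open Scope ring_scope.

(** * Gale and Bruhat orders by counting *)

Lemma all2_leq_count (s t : seq nat) (m : nat) : all2 leq s t ->
  (count (fun x => x < m)%N t <= count (fun x => x < m)%N s)%N.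
Proof.
elim: s t => [|a s IH] [|b t] //= /andP[ab /IH h].
by apply: leq_add => //; case: (ltnP b m) => // bm; rewrite (leq_ltn_trans ab bm).
Qed.

(** The smallest entry [b] of [t] is bounded below by some entry of [s], since
    values below [b + 1] occur in [s] as well; removing the two heads preserves the
    counting inequalities, because nothing in [t] lies below [b]. *)
Lemma count_all2_leq (s t : seq nat) :
  sorted leq s -> sorted leq t -> size s = size t ->
  (forall m, (count (fun x => x < m)%N t <= count (fun x => x < m)%N s)%N) ->
  all2 leq s t.
Proof.
elim: s t => [|a s IH] [|b t] //= pa pb [sz] h.
have [sa sb] := (path_sorted pa, path_sorted pb).
have /allP amin := order_path_min leq_trans pa.
have /allP bmin := order_path_min leq_trans pb.
apply/andP; split.
  have : has (fun x => x < b.+1)%N (a :: s).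
    by rewrite has_count; apply: leq_trans (h b.+1); rewrite ltnSn.
  case/orP => [//|/hasP[x xs xb]].
  exact: leq_trans (amin _ xs) xb.
apply: IH => // m; have := h m.
case: (ltnP b m) => [bm|mb _].
  by case: (a < m)%N => /=; rewrite ?add1n ?add0n ?ltnS // => /ltnW.
rewrite (_ : count _ t = 0%N) //; apply/eqP; rewrite -leqn0 leqNgt -has_count.
by apply/hasPn => x /bmin bx; rewrite -leqNgt (leq_trans mb bx).
Qed.

Section Gale.
Variable n : nat.
Implicit Types (r : nat) (I J : {set 'I_n}).

Lemma count_cyc_sort r (a : pred nat) I :
  count a [seq cyc_pos r i | i <- cyc_sort r I]
    = #|[set i in I | a (cyc_pos r i)]|.
Proof.
rewrite count_map (seq.permP (permEl (perm_sort _ _))) cardsE cardE.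
by rewrite -size_filter -filter_predI; congr size; apply: eq_filter => i /=; rewrite andbC.
Qed.

Lemma gale_leE r I J :
  gale_le r I J = all2 leq [seq cyc_pos r i | i <- cyc_sort r I]
                           [seq cyc_pos r i | i <- cyc_sort r J].
Proof.
rewrite /gale_le; elim: (cyc_sort r I) (cyc_sort r J) => [|a s IH] [|b t] //=.
by rewrite IH.
Qed.

Lemma gale_le_count r I J m : gale_le r I J ->
  (#|[set i in J | cyc_pos r i < m]| <= #|[set i in I | cyc_pos r i < m]|)%N.
Proof. by rewrite gale_leE -!(count_cyc_sort r (fun x => x < m)%N); exact: all2_leq_count. Qed.

Lemma count_gale_le r I J : #|I| = #|J| ->
  (forall m, #|[set i in J | (cyc_pos r i < m)%N]|
             <= #|[set i in I | (cyc_pos r i < m)%N]|)%N ->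
  gale_le r I J.
Proof.
have srt K : sorted leq [seq cyc_pos r i | i <- cyc_sort r K].
  by rewrite sorted_map; apply: sort_sorted => i j; exact: leq_total.
move=> cIJ h; rewrite gale_leE; apply: count_all2_leq => // [|m].
  by rewrite !size_map !size_sort -!cardE.
by rewrite !count_cyc_sort.
Qed.

Lemma cyc_pos0 (i : 'I_n) : cyc_pos 0 i = i.
Proof. by rewrite /cyc_pos subn0 modnDr modn_small. Qed.

Lemma cyc_posE r (i : 'I_n) : (r < n)%N ->
  cyc_pos r i = if (r <= i)%N then (i - r)%N else (i + (n - r))%N.
Proof.
move=> rn; have ltin := ltn_ord i; rewrite /cyc_pos; case: ifP => ri.
  rewrite (_ : i + (n - r) = (i - r) + n)%N; last by lia.
  by rewrite modnDr modn_small //; lia.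
by rewrite modn_small //; lia.
Qed.

(** Changing the start of the cyclic order alters a comparison by a difference of
    one-variable terms, which cancels when summed over a permutation. *)
Lemma cyc_ltE r (i j : 'I_n) : (r < n)%N ->
  ((cyc_lt r i j) + (r <= j) = (i < j) + (r <= i))%N.
Proof.
move=> rn; rewrite /cyc_lt !cyc_posE //.
have := ltn_ord i; have := ltn_ord j.
by case: (leqP r i) => ?; case: (leqP r j) => ? ? ?; lia.
Qed.

Lemma perm_initial_count (w : 'S_n) m (a : pred 'I_n) :
  #|[set i in perm_initial w m | a i]| = #|[set p : 'I_n | (p < m)%N & a (w p)]|.
Proof.
rewrite -[RHS](card_imset _ (@perm_inj _ w)); apply: eq_card => i; rewrite !inE.
apply/andP/imsetP => [[/imsetP[p]]|[p]].
  by rewrite inE => pm -> ap; exists p; rewrite // !inE pm.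
by rewrite !inE => /andP[pm ap] ->; rewrite imset_f ?inE.
Qed.

Lemma card_perm_initial (w : 'S_n) m : (m <= n)%N -> #|perm_initial w m| = m.
Proof.
move=> mn; rewrite card_imset; last exact: perm_inj.
rewrite -sum1_card (eq_bigl (fun i : 'I_n => (i < m)%N)) => [|i]; last by rewrite inE.
by rewrite -(big_ord_widen _ (fun=> 1%N)) // sum1_card card_ord.
Qed.

Lemma card_perm_preim (x : 'S_n) (a : pred 'I_n) :
  #|[set p | a (x p)]| = #|[set i | a i]|.
Proof.
rewrite -[LHS](card_imset _ (@perm_inj _ x)); apply: eq_card => i; rewrite !inE.
apply/imsetP/idP => [[p]|ai]; first by rewrite inE => ap ->.
by exists ((x^-1)%g i); rewrite ?inE permKV.
Qed.

Lemma card_perm_preim_split (x : 'S_n) (a P : pred 'I_n) :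
  (#|[set p | a (x p) && P p]| + #|[set p | a (x p) && ~~ P p]|)%N
    = #|[set i | a i]|.
Proof.
rewrite -(card_perm_preim x) -(cardsID [set p | P p] [set p | a (x p)]).
congr (_ + _)%N; apply: eq_card => p; rewrite !inE //=.
by rewrite andbC.
Qed.

Lemma bruhat_le_count (u v : 'S_n) a t : bruhat_le u v -> (a <= n)%N ->
  (#|[set p : 'I_n | (p < a) & (v p < t)]|
     <= #|[set p : 'I_n | (p < a) & (u p < t)]|)%N.
Proof.
case: a => [|a] /forallP uv an.
  by rewrite (eq_card0 (A := [set p : 'I_n | _ & (v p < t)%N])) // => p; rewrite !inE.
have E (w : 'S_n) : #|[set i in perm_initial w a.+1 | (cyc_pos 0 i < t)%N]|
    = #|[set p : 'I_n | (p < a.+1)%N & (w p < t)%N]|.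
  rewrite (perm_initial_count w a.+1 (fun i => cyc_pos 0 i < t)%N).
  by apply: eq_card => p; rewrite !inE cyc_pos0.
by have := gale_le_count t (uv (Ordinal an)); rewrite !E.
Qed.
End Gale.

(** * Grassmann necklaces and Bruhat intervals *)

Section Necklace.
Variables (n : nat) (wt : decorated_perm n).
Local Notation w := (dperm wt).

Definition clockwise_fixpoints : {set 'I_n} :=
  [set val h | h : {i : 'I_n | w i == i} & is_clockwise (dcolor h)].

Lemma clockwise_fixpoints_fix i : i \in clockwise_fixpoints -> w i = i.
Proof. by case/imsetP => -[j wj] _ ->; exact/eqP. Qed.

Lemma necklaceE r i : (i \in grassmann_necklace wt r)
  = cyc_lt r i ((w^-1)%g i) || (i \in clockwise_fixpoints).
Proof. by rewrite !inE. Qed.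

Lemma card_grassmann_necklace r : (r < n)%N ->
  #|grassmann_necklace wt r| = #|grassmann_necklace wt 0|.
Proof.
have cardE0 s : #|grassmann_necklace wt s|
    = (\sum_i (cyc_lt s i ((w^-1)%g i) : nat) + #|clockwise_fixpoints|)%N.
  rewrite /grassmann_necklace cardsU (_ : _ :&: _ = set0); last first.
    apply/setP => i; rewrite !inE; apply/andP => -[lt_i /clockwise_fixpoints_fix wi].
    by move: lt_i; rewrite -{2}wi permK /cyc_lt ltnn.
  rewrite cards0 subn0; congr (_ + _)%N.
  by rewrite cardsE -sum1_card big_mkcond.
have reidx (a : pred 'I_n) : (\sum_i (a ((w^-1)%g i) : nat) = \sum_i (a i : nat))%N.
  by rewrite [RHS](reindex_inj (@perm_inj _ (w^-1)%g)).
move=> rn; rewrite !cardE0; congr (_ + _)%N.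
apply/eqP; rewrite -(eqn_add2r (\sum_(i : 'I_n) ((r <= i)%N : nat))%N) -{1}(reidx (fun i : 'I_n => r <= i)%N).
apply/eqP; rewrite -!big_split /=; apply: eq_bigr => i _.
by rewrite cyc_ltE // /cyc_lt !cyc_pos0.
Qed.
End Necklace.

Section IntervalInPositroid.
Variables (n : nat) (wt : decorated_perm n) (k : nat) (u v y : 'S_n).
Implicit Types p : 'I_n.
Hypothesis hwt : of_type wt k.
Hypothesis huv : grassmann_interval wt k u v.
Hypothesis hy : y \in bruhat_interval u v.
Local Notation w := (dperm wt).

Lemma of_type_leq : (k <= n)%N.
Proof. by rewrite -hwt -[X in (_ <= X)%N]card_ord max_card. Qed.

Lemma mem_necklace_u r p : (u p \in grassmann_necklace wt r)
  = cyc_lt r (u p) (v p) || (u p \in clockwise_fixpoints wt).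
Proof. by case: huv => _ _ ->; rewrite necklaceE permM permK. Qed.

Lemma necklace0_u p : (u p \in grassmann_necklace wt 0) = (p < k)%N.
Proof.
case: huv => _ vk uE.
have : (v p \in perm_initial v k) = (p < k)%N.
  by rewrite mem_imset ?inE //; exact: perm_inj.
rewrite vk => <-; rewrite uE permM -[in RHS](permK w (v p)) mem_imset //.
exact: perm_inj.
Qed.

Lemma u_leq_v p : (p < k)%N -> (u p <= v p)%N.
Proof.
rewrite -necklace0_u mem_necklace_u /cyc_lt !cyc_pos0 => /orP[/ltnW //|].
move/clockwise_fixpoints_fix; case: huv => _ _ ->; rewrite permM.
by move/perm_inj => ->.
Qed.

Lemma v_leq_u p : (k <= p)%N -> (v p <= u p)%N.
Proof.
by rewrite leqNgt -necklace0_u mem_necklace_u /cyc_lt !cyc_pos0 negb_or -leqNgt => /andP[].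
Qed.

(** On the positions from [k] on, [v] increases, so the values at least [r] occupy a
    final segment. *)
Lemma last_cut r : exists2 a, (k <= a <= n)%N &
  forall p : 'I_n, ((k <= p) && (r <= v p))%N = (a <= p)%N.
Proof.
case: huv => gv _ _.
pose P a := (k <= a)%N && [forall p : 'I_n, (a <= p)%N ==> (r <= v p)%N].
have exP : exists a, P a.
  exists n; rewrite /P of_type_leq; apply/forallP => p.
  by rewrite leqNgt ltn_ord.
case: (ex_minnP exP) => a /andP[ka /forallP ha] amin; exists a.
  rewrite ka; apply: amin; rewrite /P of_type_leq; apply/forallP => p.
  by rewrite leqNgt ltn_ord.
move=> p; apply/andP/idP => [[kp rp]|ap]; last first.
  by rewrite (leq_trans ka ap); have /implyP/(_ ap) := ha p.
apply: amin; rewrite /P kp; apply/forallP => q; apply/implyP.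
rewrite leq_eqVlt => /orP[/eqP/val_inj <- //|pq].
by apply: leq_trans rp _; apply: ltnW; apply: gv => //; rewrite kp orbT.
Qed.

Lemma first_cut r : exists2 b, (b <= k)%N &
  forall p : 'I_n, ((p < k) && (v p < r))%N = (p < b)%N.
Proof.
case: huv => gv _ _.
pose P b := (b <= k)%N && [forall p : 'I_n, (p < b)%N ==> (v p < r)%N].
have exP : exists b, P b by exists 0%N; apply/andP; split=> //; apply/forallP.
have bdP b : P b -> (b <= k)%N by case/andP.
case: (ex_maxnP exP bdP) => b /andP[bk /forallP hb] bmax; exists b => // p.
apply/andP/idP => [[pk vp]|pb]; last first.
  by rewrite (leq_trans pb bk); have /implyP/(_ pb) := hb p.
apply: bmax; rewrite /P pk; apply/forallP => q; apply/implyP.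
rewrite ltnS leq_eqVlt => /orP[/eqP/val_inj -> //|qp].
by apply: ltn_trans vp; apply: gv => //; rewrite pk.
Qed.

Lemma bruhat_u_y a t : (a <= n)%N ->
  (#|[set p : 'I_n | (p < a) & (y p < t)]|
     <= #|[set p : 'I_n | (p < a) & (u p < t)]|)%N.
Proof. by move: hy; rewrite inE => /andP[uy _]; exact: bruhat_le_count. Qed.

Lemma bruhat_y_v a t : (a <= n)%N ->
  (#|[set p : 'I_n | (p < a) & (v p < t)]|
     <= #|[set p : 'I_n | (p < a) & (y p < t)]|)%N.
Proof. by move: hy; rewrite inE => /andP[_ yv]; exact: bruhat_le_count. Qed.

(** Bounds the number of elements of [y[k]] in an interval by complementation:
    it suffices that [y] takes values of the interval at positions from [k] on
    at least as often as [u] takes values of the interval outside the necklace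
    set. *)
Lemma interval_count r e :
  (forall p, (r <= u p < e)%N -> u p \notin grassmann_necklace wt r ->
     (r <= v p)%N /\ (k <= p)%N) ->
  (#|[set i in perm_initial y k | r <= i < e]|
    <= #|[set i in grassmann_necklace wt r | r <= i < e]|)%N.
Proof.
move=> hr.
have [a /andP[ka an] aE] := last_cut r.
rewrite (perm_initial_count y k (fun i => r <= i < e)%N).
rewrite -(leq_add2r #|[set p : 'I_n | (r <= y p < e)%N && ~~ (p < k)%N]|).
have -> : #|[set p : 'I_n | (p < k)%N & (r <= y p < e)%N]|
   = #|[set p : 'I_n | (r <= y p < e)%N && (p < k)%N]|.
  by apply: eq_card => p; rewrite !inE andbC.
rewrite (card_perm_preim_split y (fun i => r <= i < e)%N) -(card_perm_preim_split u (fun i => r <= i < e)%N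
   (fun p => u p \in grassmann_necklace wt r)).
have -> : #|[set p | (r <= u p < e)%N && (u p \in grassmann_necklace wt r)]|
   = #|[set i in grassmann_necklace wt r | (r <= i < e)%N]|.
  rewrite (card_perm_preim u (fun i => (r <= i < e)%N && (i \in grassmann_necklace wt r))).
  by apply: eq_card => p; rewrite !inE andbC.
rewrite leq_add2l.
(* Counting positions from [a] on reverses the Bruhat inequalities. *)
pose A (x : 'S_n) t := #|[set p : 'I_n | (a <= p)%N & (x p < t)%N]|.
have AE x t : (A x t + #|[set p : 'I_n | (p < a)%N & (x p < t)%N]|
     = #|[set i : 'I_n | (i < t)%N]|)%N.
  rewrite -(card_perm_preim_split x (fun i => i < t)%N (fun p => p < a)%N) addnC.
  by congr (_ + _)%N; apply: eq_card => p; rewrite !inE -?leqNgt andbC.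
have Auy t : (A u t <= A y t)%N.
  have := bruhat_u_y t an; have := AE u t; have := AE y t; lia.
have Ayv t : (A y t <= A v t)%N.
  have := bruhat_y_v t an; have := AE v t; have := AE y t; lia.
(* From [a] on no value of [v] is below [r], hence none of [y] is. *)
have Ay0 p : (a <= p)%N -> (r <= y p)%N.
  move=> ap; rewrite leqNgt; apply/negP => ypr.
  have : (0 < A y r)%N by apply/card_gt0P; exists p; rewrite inE ap.
  move=> /leq_trans/(_ (Ayv r))/card_gt0P[q]; rewrite inE -aE => /andP[/andP[_ h1] h2].
  by rewrite ltnNge h1 in h2.
apply: leq_trans (leq_trans (Auy e) _); apply: subset_leq_card; apply/subsetP => p.
  rewrite inE => /andP[/[dup] /andP[_ ue] hu /(hr _ hu)[rv kp]]; rewrite inE.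
  by rewrite -aE kp rv ue.
by rewrite !inE => /andP[ap ye]; rewrite Ay0 // ye -leqNgt (leq_trans ka ap).
Qed.

(** The interval here is the complement of a cyclic interval that wraps around,
    which is why the inequality is opposite to that of [interval_count]. *)
Lemma wrapped_count r s :
  (forall p, (s <= u p < r)%N -> u p \in grassmann_necklace wt r ->
     (v p < r)%N /\ (p < k)%N) ->
  (#|[set i in grassmann_necklace wt r | s <= i < r]|
    <= #|[set i in perm_initial y k | s <= i < r]|)%N.
Proof.
move=> hr.
have [b bk bE] := first_cut r.
have bn := leq_trans bk of_type_leq.
rewrite (perm_initial_count y k (fun i => s <= i < r)%N).
have <- : #|[set p | (s <= u p < r)%N && (u p \in grassmann_necklace wt r)]|
   = #|[set i in grassmann_necklace wt r | (s <= i < r)%N]|.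
  rewrite (card_perm_preim u (fun i => (s <= i < r)%N && (i \in grassmann_necklace wt r))).
  by apply: eq_card => p; rewrite !inE andbC.
pose B (x : 'S_n) t := #|[set p : 'I_n | (p < b)%N & (x p < t)%N]|.
pose B' (x : 'S_n) t := #|[set p : 'I_n | (p < b)%N & (t <= x p)%N]|.
have BE x t : (B x t + B' x t = #|[set p : 'I_n | (p < b)%N]|)%N.
  rewrite -(cardsID [set p : 'I_n | (x p < t)%N] [set p : 'I_n | (p < b)%N]).
  by congr (_ + _)%N; apply: eq_card => p; rewrite !inE // andbC leqNgt.
have Buy : (B' u s <= B' y s)%N.
  have := bruhat_u_y s bn; have := BE u s; have := BE y s; rewrite -/(B u s) -/(B y s); lia.
have Byv : (B' y r <= B' v r)%N.
  have := bruhat_y_v r bn; have := BE v r; have := BE y r; rewrite -/(B y r) -/(B v r); lia.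
(* Before [b] all values of [v] are below [r], hence so are those of [y]. *)
have By0 p : (p < b)%N -> (y p < r)%N.
  move=> pb; rewrite ltnNge; apply/negP => ypr.
  have : (0 < B' y r)%N by apply/card_gt0P; exists p; rewrite inE pb.
  move=> /leq_trans/(_ Byv)/card_gt0P[q]; rewrite inE -bE => /andP[/andP[_ h1] h2].
  by rewrite ltnNge h2 in h1.
apply: leq_trans (leq_trans Buy _); apply: subset_leq_card; apply/subsetP => p.
  rewrite inE => /andP[/[dup] /andP[us _] hu /(hr _ hu)[rv kp]]; rewrite inE.
  by rewrite -bE kp rv us.
by rewrite !inE => /andP[pb ys]; rewrite By0 // ys (leq_trans pb bk).
Qed.

(** The first [m] elements from [r] on form the interval from [r] to [r + m - 1]
    if [r + m <= n]; otherwise the last [n - m] ones form the interval from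
    [r + m - n] to [r - 1].  On the first interval [<_r] is the usual order, so
    that a value of [u] outside the necklace set is taken at a position from [k]
    on; on the second one a value in the necklace set is taken before [k]. *)
Lemma interval_sub_positroid : perm_initial y k \in positroid wt k.
Proof.
have cJ := card_perm_initial y of_type_leq.
rewrite inE cJ eqxx; apply/forallP => -[r rn] /=.
have cI : #|grassmann_necklace wt r| = k by rewrite card_grassmann_necklace.
apply: count_gale_le => [|m]; first by rewrite cI cJ.
have [rm|nrm] := leqP (r + m) n.
  have E (I : {set 'I_n}) : #|[set i in I | (cyc_pos r i < m)%N]|
       = #|[set i in I | (r <= i < r + m)%N]|.
    apply: eq_card => i; rewrite !inE cyc_posE //; congr (_ && _).
    by have := ltn_ord i; case: (leqP r i); lia.
  rewrite !E; apply: interval_count => p hp.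
  rewrite mem_necklace_u negb_or /cyc_lt -leqNgt !cyc_posE // => /andP[hle ncw].
  have uvp : (r <= v p <= u p)%N.
    by move: hle hp; case: (leqP r (v p)); case: (leqP r (u p)); have := ltn_ord (u p); lia.
  split; first by lia.
  rewrite leqNgt; apply/negP => pk; have := u_leq_v pk => uv.
  move: pk; rewrite -necklace0_u mem_necklace_u (negbTE ncw) orbF /cyc_lt !cyc_pos0.
  by lia.
have E (I : {set 'I_n}) : #|I| = k -> (#|[set i in I | (cyc_pos r i < m)%N]|
       + #|[set i in I | (r + m - n <= i < r)%N]| = k)%N.
  move=> <-; rewrite -(cardsID [set i | (cyc_pos r i < m)%N] I).
  congr (_ + _)%N; apply: eq_card => i; rewrite !inE //.
  rewrite cyc_posE // andbC; congr (_ && _).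
  by have := ltn_ord i; case: (leqP r i); lia.
rewrite -(leq_add2r #|[set i in perm_initial y k | (r + m - n <= i < r)%N]|) E //.
rewrite -{1}(E _ cI) leq_add2l; apply: wrapped_count => p hp.
rewrite mem_necklace_u => /orP[|cw].
  rewrite /cyc_lt !cyc_posE // => hlt.
  have uvp : (u p < v p < r)%N.
    by move: hlt hp; have := ltn_ord (v p); case: (leqP r (v p)); case: (leqP r (u p)); lia.
  split; first by lia.
  by rewrite ltnNge; apply/negP => /v_leq_u; lia.
have pk : (p < k)%N by rewrite -necklace0_u mem_necklace_u cw orbT.
split=> //; move/clockwise_fixpoints_fix: cw (hp); case: huv => _ _ ->.
by rewrite permM => /perm_inj ->; lia.
Qed.
End IntervalInPositroid.

(** * Maximal minors of matrices with unit vector rows *)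

Section Minors.
Variables (k n : nat).
Implicit Types (I J : {set 'I_n}) (c : 'I_k -> 'I_n).

Definition elt I (cI : #|I| = k) (a : 'I_k) : 'I_n := enum_val (cast_ord (esym cI) a).

Lemma elt_inj I (cI : #|I| = k) : injective (elt cI).
Proof. by move=> a b /enum_val_inj/cast_ord_inj. Qed.

Lemma elt_imset I (cI : #|I| = k) : elt cI @: setT = I.
Proof.
apply/eqP; rewrite eqEcard card_imset ?cardsT ?card_ord ?cI ?leqnn ?andbT; last exact: elt_inj.
by apply/subsetP => _ /imsetP[a _ ->]; apply: enum_valP.
Qed.

Lemma minorE (S : comNzRingType) I (cI : #|I| = k) (A : 'M[S]_(k, n)) :
  minor I A = \det (colsub (elt cI) A).
Proof.
congr (\det _); apply/matrixP => i a; rewrite !mxE.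
have ai : (a < size (enum I))%N by rewrite -cardE cI.
have x0 : 'I_n by case: (enum I) ai.
by rewrite (nth_map x0) // /elt (enum_val_nth x0).
Qed.

Lemma map_minor (S T : comNzRingType) (f : {rmorphism S -> T}) I (A : 'M[S]_(k, n)) :
  minor I (map_mx f A) = f (minor I A).
Proof.
rewrite /minor -det_map_mx; congr (\det _); apply/matrixP => i a; rewrite !mxE.
elim: (enum I) (nat_of_ord a) => [|j s IH] [|b] //=; rewrite ?rmorph0 //.
by rewrite mxE.
Qed.

Definition unit_rows (S : comNzRingType) c : 'M[S]_(k, n) :=
  \matrix_(i, j) (j == c i)%:R.

(** If [c] is a bijection onto [I], the columns in [I] form a permutation matrix;
    otherwise they have two equal rows or a zero row. *)
Lemma minor_unit_rows (S : comNzRingType) I c : #|I| = k ->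
  (minor I (unit_rows S c) != 0) = (c @: setT == I).
Proof.
move=> cI; rewrite (minorE cI).
apply/idP/eqP => [dn0|cE].
  have cinj : injective c.
    move=> i i' ci; apply/eqP; apply: contraNT dn0 => ii'; apply/eqP.
    by apply: (determinant_alternate ii') => a; rewrite !mxE ci.
  have cs : c @: setT \subset I.
    apply/subsetP => _ /imsetP[i _ ->]; apply: contraNT dn0 => ci.
    rewrite (expand_det_row _ i) big1 // => a _; rewrite !mxE.
    by case: eqP => [ea|_]; rewrite ?mul0r //; case/negP: ci; rewrite -ea; apply: enum_valP.
  by apply/eqP; rewrite eqEcard cs cI card_imset // cardsT card_ord leqnn.
have ei i : exists a, elt cI a == c i.
  have : c i \in elt cI @: setT by rewrite elt_imset -cE imset_f.
  by case/imsetP => a _ ->; exists a.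
pose s i := xchoose (ei i); have sE i : elt cI (s i) = c i := eqP (xchooseP (ei i)).
have cinj : injective c.
  have /imset_injP : #|c @: setT| == #|[set: 'I_k]| by rewrite cE cI cardsT card_ord.
  by move=> h i j; apply: h; rewrite inE.
have sinj : injective s by move=> i j /(congr1 (elt cI)); rewrite !sE; exact: cinj.
rewrite (_ : colsub _ _ = perm_mx (perm sinj)); last first.
  apply/matrixP => i a; by rewrite !mxE permE -sE (inj_eq (@elt_inj _ cI)) eq_sym.
by rewrite det_perm signr_eq0.
Qed.

Definition set_row (S : comNzRingType) (A : 'M[S]_(k, n)) i0 j0 : 'M[S]_(k, n) :=
  \matrix_(i, j) if i == i0 then (j == j0)%:R else A i j.

(** The line [A + t E] through [A] in the direction of an elementary matrix, with
    the parameter [t] as the polynomial variable. *)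
Definition line (S : comNzRingType) (A : 'M[S]_(k, n)) i0 j0 : 'M[{poly S}]_(k, n) :=
  map_mx polyC A + 'X *: delta_mx i0 j0.

(** The determinant is affine in the row of index [i0]. *)
Lemma minor_line (S : comNzRingType) I (A : 'M[S]_(k, n)) i0 j0 : #|I| = k ->
  minor I (line A i0 j0) = (minor I A)%:P + 'X * (minor I (set_row A i0 j0))%:P.
Proof.
move=> cI; rewrite -!(map_minor polyC) !(minorE cI).
rewrite -[X in X + _]mul1r; apply: (determinant_multilinear (i0 := i0)).
- apply/rowP => a; rewrite !mxE eqxx mul1r; case: (elt cI a == j0) => //=.
- apply/matrixP => i a; rewrite !mxE [_ == i0]eq_sym (negbTE (neq_lift _ _)) /=.
  by rewrite mulr0 addr0.
- apply/matrixP => i a; rewrite !mxE [_ == i0]eq_sym (negbTE (neq_lift _ _)) /=.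
  by rewrite mulr0 addr0.
Qed.

End Minors.

(** * Polynomials restricted to a line *)

Lemma mpoly_alg_ind (S : comNzRingType) m (P : {mpoly S[m]} -> Prop) :
  (forall a, P a%:MP) -> (forall i, P 'X_i) ->
  (forall f g, P f -> P g -> P (f + g)) -> (forall f g, P f -> P g -> P (f * g)) ->
  forall f, P f.
Proof.
move=> PC PX PD PM; elim/mpolyind => [|a mm f _ _ Pf]; first by rewrite -mpolyC0.
apply: PD => //; rewrite -mul_mpolyC; apply: (PM) => //; rewrite mpolyXE_id.
apply: (big_ind P) => [|g1 g2|i _]; [by rewrite -mpolyC1 | exact: PM | ].
by elim: (mm i) => [|d IH]; rewrite ?expr0 ?exprS -?mpolyC1 //; exact: PM.
Qed.

Section Line.
Variables (S : comNzRingType) (m : nat).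
Implicit Types (f : {mpoly S[m]}).

Lemma horner_mmap (h : 'I_m -> {poly S}) f t :
  (mmap polyC h f).[t] = f.@[fun c => (h c).[t]].
Proof.
elim/mpoly_alg_ind: f => [a|i|f g IHf IHg|f g IHf IHg].
- by rewrite mmapC mevalC hornerC.
- by rewrite mmapX mmap1U mevalXU.
- by rewrite mmapD mevalD hornerD IHf IHg.
- by rewrite rmorphM mevalM hornerM IHf IHg.
Qed.

(** The chain rule for the substitution of the line through [a] parallel to the
    axis of [c0]. *)
Lemma deriv_mmap (a : 'I_m -> S) (c0 : 'I_m) f :
  let h c := (a c)%:P + (c == c0)%:R * 'X in
  (mmap polyC h f)^`() = mmap polyC h (f^`M(c0)).
Proof.
move=> h; elim/mpoly_alg_ind: f => [b|i|f g IHf IHg|f g IHf IHg].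
- by rewrite mmapC derivC mderivC mmap0.
- rewrite mmapX mmap1U mderivX mmapZ mmapX /h derivD derivC add0r mnmE.
  case: (i =P c0) => [->|_] /=; last by rewrite !mul0r deriv0.
  rewrite (_ : (U_(c0) - U_(c0))%MM = 0%MM) ?mmap11 ?mul1r ?derivX //.
  by apply/mnmP => j; rewrite mnmBE mnm0E subnn.
- by rewrite mmapD derivD IHf IHg mderivD mmapD.
- by rewrite rmorphM derivM IHf IHg mderivM mmapD !rmorphM.
Qed.
End Line.
Lemma poly_eq0_horner (C : numDomainType) (p : {poly C}) :
  (forall t, p.[t] = 0) -> p = 0.
Proof.
move=> p0; apply/eqP; apply/negPn/negP => pn0.
have := max_poly_roots (rs := [seq i%:R | i <- iota 0 (size p)]) pn0.
rewrite size_map size_iota ltnn => h.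
suff : false by []; apply: h.
  by apply/allP => t _; apply/rootP.
rewrite map_inj_uniq ?iota_uniq // => i i' /eqP.
by rewrite eqr_nat => /eqP.
Qed.

Lemma rank_minor (C : fieldType) (k n : nat) (I : {set 'I_n}) (A : 'M[C]_(k, n)) :
  #|I| = k -> minor I A != 0 -> \rank A = k.
Proof.
move=> cI; rewrite (minorE cI) -unitfE -unitmxE => /mxrank_unit rk.
apply/eqP; rewrite eqn_leq rank_leq_row -{1}rk.
by rewrite -[X in colsub _ X]mulmx1 -mulmx_colsub mxrankM_maxl.
Qed.

(** Nonzero rows with disjoint supports are independent. *)
Lemma rank_sparse_columns (C : fieldType) (q p : nat) (B : 'M[C]_(q, p)) :
  (forall s s' c, B s c != 0 -> B s' c != 0 -> s = s') ->
  \rank B = #|[set s | row s B != 0]|.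
Proof.
move=> sparse; set N := [set s | _].
apply/eqP; rewrite eqn_leq; apply/andP; split.
  apply: leq_trans (rank_leq_row (rowsub (@enum_val _ (mem N)) B)).
  apply: mxrankS; apply/row_subP => s.
  have [->|sN] := eqVneq (row s B) 0; first exact: sub0mx.
  have sinN : s \in N by rewrite inE.
  rewrite (_ : row s B = row (enum_rank_in sinN s) (rowsub enum_val B)) ?row_sub //.
  by apply/rowP => c; rewrite !mxE enum_rankK_in.
suff /eqP <- : row_free (rowsub (@enum_val _ (mem N)) B).
  by rewrite -[X in rowsub _ X]mul1mx -mul_rowsub_mx mxrankM_maxr.
apply: inj_row_free => x xB; apply/rowP => a; rewrite mxE.
have := enum_valP a; rewrite inE => /rV0Pn[c]; rewrite mxE => Bc.
move/rowP/(_ c): xB; rewrite !mxE (bigD1 a) //= big1 => [|b ba].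
  by rewrite mxE addr0 => /eqP; rewrite mulf_eq0 (negbTE Bc) orbF => /eqP.
rewrite mxE; have [->|Bb] := eqVneq (B (enum_val b) c) 0; first by rewrite mulr0.
by case/eqP: ba; apply: enum_val_inj; apply: sparse Bb Bc.
Qed.

Section Tangent.
Variables (C : numFieldType) (n k : nat).
Implicit Types (A X : 'M[C]_(k, n)) (f : {mpoly C[k * n]}) (I J : {set 'I_n}).

Definition restrict_line A i0 j0 f : {poly C} :=
  mmap polyC (fun c => mxvec (line A i0 j0) 0 c) f.

Lemma mxvec_line A i0 j0 c : mxvec (line A i0 j0) 0 c
  = (mxvec A 0 c)%:P + (c == mxvec_index i0 j0)%:R * 'X.
Proof.
by rewrite /line linearD linearZ /= mxvec_delta -map_mxvec !mxE eqxx mulrC.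
Qed.

Lemma horner_restrict_line A i0 j0 f t :
  (restrict_line A i0 j0 f).[t] = eval_at (A + t *: delta_mx i0 j0) f.
Proof.
rewrite /restrict_line horner_mmap /eval_at; apply: meval_eq => c.
rewrite mxvec_line linearD linearZ /= mxvec_delta !mxE eqxx /=.
by rewrite hornerD hornerM hornerC hornerX -polyC_natr hornerC mulrC.
Qed.

Lemma deriv_restrict_line A i0 j0 f :
  (restrict_line A i0 j0 f)^`().[0] = eval_at A (f^`M(mxvec_index i0 j0)).
Proof.
have mE g : restrict_line A i0 j0 g = mmap polyC (fun c =>
    (mxvec A 0 c)%:P + (c == mxvec_index i0 j0)%:R * 'X) g.
  by apply: eq_bigr => m _; congr (_ * _); apply: mmap1_eq => c; rewrite mxvec_line.
rewrite mE deriv_mmap -mE horner_restrict_line.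
by rewrite scale0r addr0.
Qed.

Lemma restrict_line_Delta A i0 j0 I :
  restrict_line A i0 j0 (@Delta C n k I) = minor I (line A i0 j0).
Proof.
rewrite /restrict_line /Delta -[LHS]map_minor; congr minor.
by apply/matrixP => i j; rewrite !mxE /= mmapX mmap1U mxvecE !mxE.
Qed.

Lemma eval_Delta A I : eval_at A (@Delta C n k I) = minor I A.
Proof.
rewrite /eval_at /Delta -[LHS]map_minor; congr minor.
by apply/matrixP => i j; rewrite !mxE /= mevalXU mxvecE.
Qed.

Lemma eval_mderiv_Delta A i0 j0 I : #|I| = k ->
  eval_at A ((@Delta C n k I)^`M(mxvec_index i0 j0)) = minor I (set_row A i0 j0).
Proof.
move=> cI; rewrite -deriv_restrict_line restrict_line_Delta minor_line //.
by rewrite derivD derivC add0r derivM derivX derivC mulr0 addr0 mul1r hornerC.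
Qed.

Variable wt : decorated_perm n.
Local Notation Q := (nonbases wt k).

Lemma card_nonbasis I : I \in Q -> #|I| = k.
Proof. by rewrite !inE => /andP[_ /eqP]. Qed.

(** All minors of nonbases vanish on the line, so its points of rank [k] lie in the
    variety; the minor of [J] shows that only finitely many points have smaller
    rank.  Thus [f] vanishes on the line. *)
Lemma vanishing_mderiv0 J A i0 j0 f :
  #|J| = k -> minor J A != 0 -> in_positroid_variety wt A ->
  (forall I, I \in Q -> minor I (set_row A i0 j0) = 0) ->
  in_vanishing_ideal wt f -> eval_at A (f^`M(mxvec_index i0 j0)) = 0.
Proof.
move=> cJ AJ [_ AQ] dQ fI; rewrite -deriv_restrict_line.
suff -> : restrict_line A i0 j0 f = 0 by rewrite deriv0 horner0.
pose h := minor J (line A i0 j0).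
have hE t : h.[t] = minor J (A + t *: delta_mx i0 j0).
  by rewrite -eval_Delta -horner_restrict_line restrict_line_Delta.
(* [h] does not vanish at [t = 0]. *)
have hn0 : h != 0.
  apply: contraNneq AJ => h0; have := hE 0.
  by rewrite h0 horner0 scale0r addr0 => <-.
(* The product of the restriction of [f] with [h] vanishes at every [t]. *)
apply/eqP; rewrite -(mulIr_eq0 _ (mulIf hn0)); apply/eqP; apply: poly_eq0_horner => t.
rewrite hornerM; have [->|ht] := eqVneq h.[t] 0; first by rewrite mulr0.
rewrite horner_restrict_line fI ?mul0r //; split.
  by apply: rank_minor cJ _; rewrite -hE.
move=> I IQ; rewrite -horner_restrict_line restrict_line_Delta.
rewrite minor_line ?(card_nonbasis IQ) // dQ // -eval_Delta AQ //.
by rewrite mulr0 addr0 horner0.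
Qed.

End Tangent.

(** * Exchanges of one element *)

Section Exchange.
Variables (n k : nat) (J : {set 'I_n}) (cJ : #|J| = k).
Implicit Types (I : {set 'I_n}) (i : 'I_k) (j : 'I_n).
Local Notation e := (elt cJ).

Definition exchange i j : {set 'I_n} := j |: (J :\ e i).

Lemma coord_pointE (S : comNzRingType) : coord_point S k J = unit_rows S e.
Proof.
apply/matrixP => i j; rewrite !mxE; congr (_ %:R); congr nat_of_bool.
apply/andP/eqP => [[jJ /eqP ij]|->].
  by rewrite /elt (enum_val_nth j) /= -ij nth_index // mem_enum.
split; first exact: enum_valP.
rewrite /elt (enum_val_nth (e i)) /= index_uniq ?enum_uniq //.
by rewrite -cardE cJ.
Qed.

Lemma minor_coord_point (S : comNzRingType) I : #|I| = k ->
  (minor I (coord_point S k J) != 0) = (J == I).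
Proof. by move=> cI; rewrite coord_pointE minor_unit_rows // elt_imset. Qed.

Lemma minor_set_row_coord_point (S : comNzRingType) I i j : #|I| = k ->
  (minor I (set_row (coord_point S k J) i j) != 0) = (exchange i j == I).
Proof.
move=> cI; pose c l := if l == i then j else e l.
have -> : set_row (coord_point S k J) i j = unit_rows S c.
  apply/matrixP => i' j'; rewrite coord_pointE !mxE /c.
  by case: eqP.
rewrite minor_unit_rows //; congr (_ == _).
apply/setP => x; rewrite !inE; apply/imsetP/idP => [[l _ ->]|].
  rewrite /c; case: (l =P i) => [_|/eqP li]; first by rewrite eqxx.
  by rewrite (inj_eq (@elt_inj _ _ _ cJ)) li enum_valP orbT.
case/orP => [/eqP->|/andP[xi]]; first by exists i; rewrite // /c eqxx.
rewrite -{1}(elt_imset cJ) => /imsetP[l _ xl]; exists l => //.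
by rewrite /c; case: (l =P i) xi => // li; rewrite xl li eqxx.
Qed.

Lemma exchange_notin I i j : #|I| = k -> I != J -> exchange i j = I -> j \notin J.
Proof.
move=> cI + xE; apply: contraNN => jJ; rewrite eqEcard cI cJ leqnn andbT -xE.
by rewrite subUset sub1set jJ subD1set.
Qed.

(** [e i] is the element of [J] missing from [I], and [j] the element of [I] missing
    from [J]; they are determined since [I <> J]. *)
Lemma exchange_inj I i j i' j' : #|I| = k -> I != J ->
  exchange i j = I -> exchange i' j' = I -> i = i' /\ j = j'.
Proof.
move=> cI IJ xE xE'.
have jJ := exchange_notin cI IJ xE; have jJ' := exchange_notin cI IJ xE'.
have eiI : e i \notin I.
  rewrite -xE !inE eqxx /= orbF; apply: contraNneq jJ => <-; exact: enum_valP.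
split.
  apply: (elt_inj (cI := cJ)); apply/eqP; apply: contraNT eiI => ii'.
  by rewrite -xE' !inE ii' enum_valP orbT.
have : j \in I by rewrite -xE !inE eqxx.
by rewrite -xE' !inE (negbTE jJ) andbF orbF => /eqP.
Qed.

Lemma exchangeP I : #|I| = k -> I != J ->
  reflect (exists i j, exchange i j = I) (#|I :&: J|.+1 == k).
Proof.
move=> cI IJ; apply: (iffP eqP) => [cIJ|[i [j xE]]]; last first.
  have jJ := exchange_notin cI IJ xE.
  have -> : I :&: J = J :\ e i.
    apply/setP => x; rewrite -xE !inE; case: eqP => [->|_] /=.
      by rewrite (negbTE jJ) andbF.
    by rewrite -andbA andbb.
  have eJ : e i \in J := enum_valP _.
  by have := cardsD1 (e i) J; rewrite eJ add1n => <-.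
have /eqP/cards1P[j IDJ] : #|I :\: J| = 1%N.
  by apply: (@addnI #|I :&: J|); rewrite cardsID cI addn1.
have /eqP/cards1P[a JDI] : #|J :\: I| = 1%N.
  by apply: (@addnI #|J :&: I|); rewrite cardsID cJ setIC addn1.
have : a \in e @: setT.
  by have /setDP[aJ _] : a \in J :\: I; rewrite ?JDI ?inE ?elt_imset.
case/imsetP => i _ ai; exists i, j; apply/setP => x; rewrite !inE -ai.
have /setP/(_ x) := IDJ; have /setP/(_ x) := JDI; rewrite !inE => <- <-.
by case: (x \in I); case: (x \in J).
Qed.
End Exchange.

(** * The tangent space at a coordinate point *)

Lemma sum_mxvec_index (V : nmodType) (k n : nat) (F : 'I_(k * n) -> V) :
  \sum_c F c = \sum_(i < k) \sum_(j < n) F (mxvec_index i j).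
Proof.
rewrite pair_bigA /= (reindex _ (curry_mxvec_bij k n)) /=.
by apply: eq_bigr => -[i j] _.
Qed.

(** Coordinates in a basis of [kermx B^T] parametrize the kernel injectively. *)
Lemma kernel_vspace (C : fieldType) (q k n : nat) (B : 'M[C]_(q, k * n)) :
  exists2 T : {vspace 'M[C]_(k, n)},
    forall X, X \in T <-> B *m (mxvec X)^T = 0 & \dim T = (k * n - \rank B)%N.
Proof.
pose K := row_base (kermx B^T).
pose f (x : 'rV_(\rank (kermx B^T))) : 'M[C]_(k, n) := vec_mx (x *m K).
have fL : linear f by move=> a x x'; rewrite /f mulmxDl -scalemxAl linearP.
pose fl := HB.pack_for {linear _ -> _} f (GRing.isLinear.Build _ _ _ _ f fL).
exists (limg (linfun fl)).
  move=> X; have -> : B *m (mxvec X)^T = 0 <-> (mxvec X <= K)%MS.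
    rewrite eq_row_base; split=> [h|/sub_kermxP h].
      by apply/sub_kermxP; rewrite -[LHS]trmxK trmx_mul trmxK h trmx0.
    by rewrite -[LHS]trmxK trmx_mul trmxK h trmx0.
  split=> [/memv_imgP[x _ ->]|/submxP[x xE]].
    by rewrite lfunE /= /f vec_mxK submxMl.
  apply/memv_imgP; exists x; rewrite ?memvf // lfunE /= /f -xE.
  by rewrite mxvecK.
rewrite limg_dim_eq ?dimvf ?dim_matrix.
  by rewrite mul1r mxrank_ker mxrank_tr.
apply/eqP; rewrite -subv0; apply/subvP => x; rewrite memv_cap memv_ker => /andP[_].
rewrite lfunE /= /f memv0 => /eqP/(congr1 mxvec); rewrite vec_mxK linear0 => xK.
by apply/eqP; apply: (row_free_inj (row_base_free _)); rewrite xK mul0mx.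
Qed.

Section CoordinateTangent.
Variables (C : numFieldType) (n k : nat) (wt : decorated_perm n) (J : {set 'I_n}).
Hypothesis JM : J \in positroid wt k.
Local Notation Q := (nonbases wt k).
Local Notation A := (coord_point C k J).

Lemma card_basis : #|J| = k.
Proof. by move: JM; rewrite inE => /andP[/eqP]. Qed.
Local Notation cJ := card_basis.

Lemma nonbasis_neq I : I \in Q -> I != J.
Proof. by apply: contraTneq => ->; rewrite inE JM. Qed.

Lemma Jac_atE s i j :
  Jac_at wt A s (mxvec_index i j) = minor (enum_val s) (set_row A i j).
Proof. by rewrite !mxE eval_mderiv_Delta ?(card_nonbasis (enum_valP s)). Qed.

Lemma Jac_at_neq0 s i j :
  (Jac_at wt A s (mxvec_index i j) != 0) = (exchange cJ i j == enum_val s).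
Proof.
by rewrite Jac_atE (minor_set_row_coord_point cJ) // (card_nonbasis (enum_valP s)).
Qed.

Lemma rank_Jac_at :
  \rank (Jac_at wt A) = #|[set I in Q | (#|I :&: J|.+1 == k)%N]|.
Proof.
rewrite rank_sparse_columns => [|s s' c].
  rewrite -(card_imset _ enum_val_inj); apply: eq_card => I.
  have rowE s : (row s (Jac_at wt A) != 0) = (#|enum_val s :&: J|.+1 == k)%N.
    have sQ := enum_valP s.
    apply/rV0Pn/(exchangeP cJ (card_nonbasis sQ) (nonbasis_neq sQ)) => [[c]|[i [j xE]]].
      case/mxvec_indexP: c => i j; rewrite mxE Jac_at_neq0 => /eqP xE.
      by exists i, j.
    by exists (mxvec_index i j); rewrite mxE Jac_at_neq0 xE.
  rewrite inE; apply/imsetP/andP => [[s] | [IQ cIJ]].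
    by rewrite inE rowE => cs ->; split=> //; apply: enum_valP.
  by exists (enum_rank_in IQ I); rewrite ?inE ?rowE enum_rankK_in.
case/mxvec_indexP: c => i j; rewrite !Jac_at_neq0 => /eqP h /eqP h'.
by apply: enum_val_inj; rewrite -h -h'.
Qed.

Lemma coord_point_in_variety : in_positroid_variety wt A.
Proof.
split; first by apply: (rank_minor cJ); rewrite (minor_coord_point cJ) ?cJ.
move=> I IQ; apply/eqP; rewrite eval_Delta -[_ == _]negbK.
by rewrite (minor_coord_point cJ) ?(card_nonbasis IQ) // eq_sym nonbasis_neq.
Qed.

(** If [E_ij] leads to a nonbasis [I], the only nonzero entry of the row [I] of the
    Jacobian is in the column [x_ij], which forces [X i j = 0]; otherwise every [f] in
    the vanishing ideal has zero derivative in the direction [E_ij]. *)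
Lemma lifted_tangentE X :
  lifted_tangent wt A X <-> Jac_at wt A *m (mxvec X)^T = 0.
Proof.
have JacX s : (Jac_at wt A *m (mxvec X)^T) s 0
    = \sum_(i < k) \sum_(j < n) Jac_at wt A s (mxvec_index i j) * X i j.
  rewrite mxE sum_mxvec_index; apply: eq_bigr => i _; apply: eq_bigr => j _.
  by rewrite [_^T _ _]mxE mxvecE.
split=> [tX|/matrixP JX f fI].
  apply/colP => s; rewrite JacX mxE -[RHS](tX (@Delta C n k (enum_val s))).
    by apply: eq_bigr => i _; apply: eq_bigr => j _; rewrite !mxE.
  by move=> A' [_]; apply; apply: enum_valP.
apply: big1 => i _; apply: big1 => j _.
have [/existsP[s xE]|nx] := boolP [exists s, exchange cJ i j == @enum_val _ (mem Q) s].
  have sQ := enum_valP s; have := JX s 0; rewrite JacX mxE.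
  have sp i' j' : (i', j') != (i, j) -> Jac_at wt A s (mxvec_index i' j') = 0.
    move=> ij; apply/eqP; apply: contraNT ij; rewrite Jac_at_neq0 => /eqP xE'.
    have [-> ->] // := exchange_inj (card_nonbasis sQ) (nonbasis_neq sQ) xE' (eqP xE).
  rewrite (bigD1 i) //= (bigD1 j) //= big1 => [|j' jj']; last first.
    by rewrite sp ?mul0r // xpair_eqE eqxx.
  rewrite addr0 big1 => [|i' ii']; last first.
    by apply: big1 => j' _; rewrite sp ?mul0r // xpair_eqE (negbTE ii').
  rewrite addr0 => /eqP; rewrite mulf_eq0 => /orP[|/eqP->]; last by rewrite mulr0.
  by rewrite -[_ == 0]negbK Jac_at_neq0 xE.
rewrite (vanishing_mderiv0 cJ _ coord_point_in_variety _ fI) ?mul0r //.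
  by rewrite (minor_coord_point cJ) ?cJ.
move=> I IQ; apply/eqP; apply: contraNT nx.
rewrite (minor_set_row_coord_point cJ) ?(card_nonbasis IQ) // => xE.
by apply/existsP; exists (enum_rank_in IQ I); rewrite enum_rankK_in.
Qed.

(** A nonzero entry of the Jacobian has its column outside [J], where all rows of
    [P *m A] vanish. *)
Lemma gl_directions_tangent X : X \in gl_directions A -> lifted_tangent wt A X.
Proof.
case/memv_imgP => P _ ->; rewrite lfunE /=; apply/lifted_tangentE.
apply/colP => s; rewrite mxE sum_mxvec_index [RHS]mxE.
have sQ := enum_valP s.
apply: big1 => i _; apply: big1 => j _; rewrite [_^T _ _]mxE mxvecE.
have [->|] := eqVneq (Jac_at wt A s (mxvec_index i j)) 0; first by rewrite mul0r.
rewrite Jac_at_neq0 => /eqP xE.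
have jJ := exchange_notin (card_nonbasis sQ) (nonbasis_neq sQ) xE.
suff -> : mulmxr A P i j = 0 by rewrite mulr0.
rewrite /= mxE big1 // => l _; rewrite (coord_pointE cJ) !mxE.
by case: eqP => [jl|_]; rewrite ?mulr0 //; case/negP: jJ; rewrite jl; apply: enum_valP.
Qed.

Lemma tangent_codim_coord_point : tangent_codim wt A (\rank (Jac_at wt A)).
Proof.
have [T TE dT] := kernel_vspace (Jac_at wt A).
exists T => [X|]; first by rewrite TE lifted_tangentE.
have OT : (gl_directions A <= T)%VS.
  by apply/subvP => X /gl_directions_tangent tX; apply/TE/lifted_tangentE.
have := dimvS OT; have := rank_leq_col (Jac_at wt A).
have dM : \dim {:'M[C]_(k, n)} = (k * n)%N by rewrite dimvf dim_matrix.
rewrite /= (addv_idPl OT) dT dM.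
move: (\dim (gl_directions A)) (\rank (Jac_at wt A)) => d r.
by move: (k * n)%N => m; lia.
Qed.
End CoordinateTangent.

Theorem theorem1p5 (R : realType) (n k : nat) (wt : decorated_perm n)
    (hwt : of_type wt k) (u v : 'S_n) (huv : grassmann_interval wt k u v)
    (y : 'S_n) (hy : y \in bruhat_interval u v) :
  let J := perm_initial y k in
  let A := coord_point R[i] k J in
  tangent_codim wt A (\rank (Jac_at wt A)) /\
  \rank (Jac_at wt A)
    = #|[set I in nonbases wt k | (#|I :&: J|.+1 == k)%N]|.
Proof.
move=> J A; have JM : J \in positroid wt k := interval_sub_positroid hwt huv hy.
by split; [exact: tangent_codim_coord_point | exact: rank_Jac_at].
Qed.
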